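(* Let $t$ be an indeterminate and put $\mathcal{F}_{1}(t) = {}_{2}F_{1}\left( \tfrac{1}{12}, \tfrac{5}{12} ; 1 ; 1728t \right)$, $\mathcal{F}_{2}(t) = {}_{2}F_{1}\left( -\tfrac{1}{12}, \tfrac{7}{12} ; 1 ; 1728t \right)$ as formal power series, and let \[ \mathcal{F} := \mathbb{C}\left[ \mathcal{F}_{1}(t) \mathcal{F}_{2}(t),\ \mathcal{F}_{1}(t)^{4},\ (1-1728t)^{1/2} \mathcal{F}_{1}(t)^{6}\right]\subset \mathbb{C}[\![t]\!], \] where $(1-1728t)^{1/2}$ is the binomial series. Then the $\mathbb{C}$-algebra homomorphism $QM_{*}(SL_2(\mathbb{Z}))=\mathbb{C}[E_2,E_4,E_6]\to\mathcal{F}$ sending $E_2\mapsto \mathcal{F}_1\mathcal{F}_2$, $E_4\mapsto\mathcal{F}_1^4$, $E_6\mapsto(1-1728t)^{1/2}\mathcal{F}_1^6$ (equivalently, expanding a quasimodular form as a power series in $t=1/j(\tau)$) is a ring isomorphism $QM_*(SL_2(\mathbb{Z}))\simeq\mathcal{F}$. Moreover $\mathcal{F}$ is closed under the derivation $D_{\mathcal{F}}:=(1-1728t)^{1/2}\mathcal{F}_{1}(t)^{2}\, t \tfrac{d}{d t}$, and this isomorphism carries $D=q\tfrac{d}{dq}$ to $D_{\mathcal{F}}$, so that $(QM_{*}(SL_2(\mathbb{Z})),D) \simeq (\mathcal{F}, D_{\mathcal{F}})$ as graded differential algebras over $\mathbb{C}$.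
   Context: $q=e^{2\pi i\tau}$; $E_2,E_4,E_6$ are the standard Eisenstein series $E_2=1-24\sum\sigma_1(n)q^n$, $E_4=1+240\sum\sigma_3(n)q^n$, $E_6=1-504\sum\sigma_5(n)q^n$, which are algebraically independent, and $QM_*(SL_2(\mathbb{Z}))=\mathbb{C}[E_2,E_4,E_6]$ is the graded ring of quasimodular forms (weights $2,4,6$). $\Delta=(E_4^3-E_6^2)/1728$ and $j=E_4^3/\Delta$ is the elliptic modular function. The generalized hypergeometric series is ${}_pF_q(a_1,\dots,a_p;b_1,\dots,b_q;z)=\sum_{n\ge0}\frac{(a_1)_n\cdots(a_p)_n}{(b_1)_n\cdots(b_q)_n}\frac{z^n}{n!}$ with $(a)_n=a(a+1)\cdots(a+n-1)$. *)

(* Defs.v *)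
From HB Require Import structures.
From mathcomp Require Import all_boot all_order all_algebra.
From mathcomp Require Import reals complex.
From mathcomp Require Import mpoly.
Set Implicit Arguments. Unset Strict Implicit. Unset Printing Implicit Defensive.
Import Order.TTheory GRing.Theory Num.Theory.
Local Open Scope ring_scope.

Section PS.
Variable R : realType.
Local Notation C := (R[i]).

Definition pser := nat -> C.

Definition pscst (c : C) : pser := fun n => if n == 0%N then c else 0.
Definition psmul (f g : pser) : pser :=
  fun n => \sum_(i < n.+1) f i * g (n - i)%N.
Definition pspow (f : pser) (k : nat) : pser := iter k (psmul f) (pscst 1).

(* the Euler operator x d/dx (= q d/dq, resp. t d/dt) on formal power series *)
Definition euler (f : pser) : pser := fun n => n%:R * f n.

Definition poch (a : C) (n : nat) : C := \prod_(i < n) (a + i%:R).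

Definition hyp2F1 (a b c lam : C) : pser :=
  fun n => poch a n * poch b n / poch c n / (n`!)%:R * lam ^+ n.

Definition gbinom (a : C) (n : nat) : C := (\prod_(i < n) (a - i%:R)) / (n`!)%:R.

Definition binser (a lam : C) : pser := fun n => gbinom a n * lam ^+ n.

Definition sigma (k n : nat) : nat := \sum_(d <- divisors n) d ^ k.
Definition eis (c : C) (k : nat) : pser :=
  fun n => if n == 0%N then 1 else c * (sigma k n)%:R.
Definition E2 : pser := eis (- 24%:R) 1.
Definition E4 : pser := eis 240%:R 3.
Definition E6 : pser := eis (- 504%:R) 5.

Definition mpeval3 (x y z : pser) (P : {mpoly C[3]}) : pser :=
  fun n => \sum_(m <- msupp P)
     P@_m * psmul (pspow x (m ord0)) (psmul (pspow y (m (inord 1)))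
                                            (pspow z (m (inord 2)))) n.

Definition F1 : pser := hyp2F1 (1 / 12%:R) (5%:R / 12%:R) 1 1728%:R.
Definition F2 : pser := hyp2F1 (- (1 / 12%:R)) (7%:R / 12%:R) 1 1728%:R.
Definition sqrtser : pser := binser (1 / 2%:R) (- 1728%:R).

Definition G2 : pser := psmul F1 F2.
Definition G4 : pser := pspow F1 4.
Definition G6 : pser := psmul sqrtser (pspow F1 6).

(* quasimodular form P(E2,E4,E6) as q-series, and its image P(G2,G4,G6) *)
Definition QMser (P : {mpoly C[3]}) : pser := mpeval3 E2 E4 E6 P.
Definition Fser (P : {mpoly C[3]}) : pser := mpeval3 G2 G4 G6 P.

Definition DF (f : pser) : pser := psmul (psmul sqrtser (pspow F1 2)) (euler f).

End PS.

(* Main.v *)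
(**
The proof compares the two sides through [u = 1/j = (E4^3 - E6^2) / (1728 E4^3)],
a power series [q + O(q^2)] without constant term.

Ramanujan's equations for [D E2], [D E4], [D E6] are convolution identities for
divisor sums. The bijection [(a, b, x, y) -> (a, a + b, x - y, y)] on the solutions
of [a x + b y = n] reduces the convolution of [P a b - P a (b - a)] to boundary
terms [x = y] and [a = b]. Taking for [P] the polynomials [e2], [e2^2],
[(a b (a + b))^2], [e2^3 - 7/2 (a b (a + b))^2], where [e2 = a^2 + a b + b^2], gives
[sigma_1 * sigma_1], [sigma_1 * sigma_3], [sigma_3 * sigma_3], [sigma_1 * sigma_5].

On the other side the hypergeometric equation, together with Euler's
transformation [F2 = (1 - 1728 t)^(1/2) (F1 + 12 t F1')], shows that
[(G2, G4, G6)] solves the same equations for the derivation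
[D_F = (G6 / G4) t d/dt], and that [G4^3 - G6^2 = 1728 t G4^3]. Ramanujan's
equations give [q du/dq = (E6 / E4) u], so substituting [t = u] transports [D_F] to
[q d/dq], and uniqueness of the solution with constant terms [1] yields
[G_i(u) = E_i]. Hence [P(G2, G4, G6)] evaluated at [t = u] is [P(E2, E4, E6)] for
every polynomial [P], and [t -> u] is injective on power series.
*)
Require Import Defs.
From HB Require Import structures.
From mathcomp Require Import all_boot all_order all_algebra.
From mathcomp Require Import reals complex.
From mathcomp Require Import mpoly.
From mathcomp Require Import boolp zify ring.
Set Implicit Arguments. Unset Strict Implicit. Unset Printing Implicit Defensive.
Import GRing.Theory Num.Theory.
Local Open Scope ring_scope.

(** * Formal power series *)

(* An alias, so that the ring structure is the Cauchy product and not the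
   pointwise product of functions. *)
Definition fps (R : realType) : Type := pser R.

Section FormalPowerSeries.
Variable R : realType.
Local Notation C := (R[i]).
Implicit Types f g h : fps R.

(** Coefficient [n] of a Cauchy product sees only coefficients up to [n], so the ring laws can be
    read off from polynomial truncations. *)
Lemma psmul_poly f g (p q : {poly C}) n :
  (forall k, (k <= n)%N -> p`_k = f k) ->
  (forall k, (k <= n)%N -> q`_k = g k) -> psmul f g n = (p * q)`_n.
Proof.
move=> pf qg; rewrite coefM; apply: eq_bigr => -[i /= lei] _.
by rewrite pf // qg // leq_subr.
Qed.

Definition pstrunc (n : nat) f : {poly C} := \poly_(i < n.+1) f i.

Lemma coef_pstrunc n f k : (k <= n)%N -> (pstrunc n f)`_k = f k.
Proof. by move=> lekn; rewrite coef_poly ltnS lekn. Qed.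

Definition psadd f g : fps R := fun n => f n + g n.
Definition psopp f : fps R := fun n => - f n.

Fact psaddA : associative psadd.
Proof. by move=> f g h; apply/funext => n; rewrite /psadd addrA. Qed.
Fact psaddC : commutative psadd.
Proof. by move=> f g; apply/funext => n; rewrite /psadd addrC. Qed.
Fact psadd0 : left_id (fun=> 0) psadd.
Proof. by move=> f; apply/funext => n; rewrite /psadd add0r. Qed.
Fact psaddN : left_inverse (fun=> 0) psopp psadd.
Proof. by move=> f; apply/funext => n; rewrite /psadd addNr. Qed.

HB.instance Definition _ := gen_eqMixin (fps R).
HB.instance Definition _ := gen_choiceMixin (fps R).
HB.instance Definition _ :=
  GRing.isZmodule.Build (fps R) psaddA psaddC psadd0 psaddN.

Fact psmulA : associative (@psmul R : fps R -> fps R -> fps R).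
Proof.
move=> f g h; apply/funext => n.
have tr x k m : (m <= n)%N -> (k <= m)%N -> (pstrunc n x)`_k = x k.
  by move=> lemn lekm; apply: coef_pstrunc (leq_trans lekm lemn).
pose F := pstrunc n f; pose G := pstrunc n g; pose H := pstrunc n h.
rewrite (psmul_poly (p := F) (q := G * H)); first last.
- by move=> k lekn; apply/esym/psmul_poly => j; apply: tr.
- by move=> k; apply: tr.
rewrite mulrA; apply/esym/psmul_poly => k; last exact: tr.
by move=> lekn; apply/esym/psmul_poly => j; apply: tr.
Qed.

Fact psmulC : commutative (@psmul R : fps R -> fps R -> fps R).
Proof.
move=> f g; apply/funext => n; have tr x k := @coef_pstrunc n x k.
by rewrite (psmul_poly (tr f) (tr g)) mulrC -(psmul_poly (tr g) (tr f)).
Qed.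

Fact psmul1 : left_id (pscst 1 : fps R) (@psmul R : fps R -> fps R -> fps R).
Proof.
move=> f; apply/funext => n; rewrite /psmul big_ord_recl /= mul1r subn0.
by rewrite big1 ?addr0 // => i _; rewrite mul0r.
Qed.

Fact psmulD : left_distributive (@psmul R : fps R -> fps R -> fps R) psadd.
Proof.
move=> f g h; apply/funext => n; rewrite /psmul /psadd -big_split /=.
by apply: eq_bigr => i _; rewrite mulrDl.
Qed.

Fact psone_neq0 : (pscst 1 : fps R) != (fun=> 0).
Proof. by apply/eqP => /(congr1 (@^~ 0%N)) /eqP; rewrite /= oner_eq0. Qed.

HB.instance Definition _ := GRing.Zmodule_isComNzRing.Build (fps R)
  psmulA psmulC psmul1 psmulD psone_neq0.

Lemma fps0E n : (0 : fps R) n = 0. Proof. by []. Qed.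
Lemma fps1E n : (1 : fps R) n = (n == 0%N)%:R.
Proof. by rewrite [LHS]/(pscst 1 n) /pscst; case: (n == 0%N). Qed.
Lemma fpsDE f g n : (f + g) n = f n + g n. Proof. by []. Qed.
Lemma fpsNE f n : (- f) n = - f n. Proof. by []. Qed.
Lemma fpsBE f g n : (f - g) n = f n - g n. Proof. by []. Qed.
Lemma fpsME f g n : (f * g) n = \sum_(i < n.+1) f i * g (n - i)%N.
Proof. by []. Qed.
Lemma fpsM0 f g : (f * g) 0%N = f 0%N * g 0%N.
Proof. by rewrite fpsME big_ord1. Qed.
Lemma fpsX0 f k : (f ^+ k) 0%N = f 0%N ^+ k.
Proof. by elim: k => [|k IH]; rewrite ?fps1E // !exprS fpsM0 IH. Qed.
Lemma fpsX1 f m : f 0%N = 1 -> (f ^+ m) 1%N = m%:R * f 1%N.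
Proof.
move=> f0; elim: m => [|m IH]; first by rewrite expr0 fps1E mul0r.
rewrite exprS fpsME !big_ord_recl big_ord0 /= IH f0 fpsX0 f0 expr1n.
by rewrite -natr1; ring.
Qed.
Lemma fpsMn f k n : (f *+ k) n = f n *+ k.
Proof. by elim: k => [|k IH] //; rewrite !mulrS fpsDE IH. Qed.
Lemma fps_sumE I (r : seq I) (P : pred I) (F : I -> fps R) n :
  (\sum_(i <- r | P i) F i) n = \sum_(i <- r | P i) F i n.
Proof. by elim/big_rec2: _ => // i x y _ <-. Qed.
Lemma fps_natM k f n : (k%:R * f) n = k%:R * f n.
Proof. by rewrite !mulr_natl fpsMn. Qed.

Lemma pspowE f k : pspow f k = f ^+ k.
Proof. by elim: k => [|k IH] //; rewrite exprS -IH. Qed.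

Definition fpsC (c : C) : fps R := pscst c.

Lemma fpsCM c f n : (fpsC c * f) n = c * f n.
Proof.
rewrite fpsME big_ord_recl /= subn0 big1 ?addr0 // => i _.
by rewrite /fpsC /pscst mul0r.
Qed.

Fact fpsC_is_zmod : zmod_morphism fpsC.
Proof.
by move=> a b; apply/funext => -[|n]; rewrite /fpsC /pscst fpsBE //= subr0.
Qed.
Fact fpsC_is_monoid : monoid_morphism fpsC.
Proof.
split=> // a b; apply/funext => n; rewrite fpsCM /fpsC /pscst.
by case: eqP => // _; rewrite mulr0.
Qed.
HB.instance Definition _ := GRing.isZmodMorphism.Build C (fps R) fpsC fpsC_is_zmod.
HB.instance Definition _ := GRing.isMonoidMorphism.Build C (fps R) fpsC fpsC_is_monoid.

Lemma fps_natMI k : (0 < k)%N -> injective (fun f => k%:R * f).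
Proof.
move=> k_gt0 f g fg; apply/funext => n; have := congr1 (@^~ n) fg.
by rewrite /= !fps_natM; apply: mulfI; rewrite pnatr_eq0 -lt0n.
Qed.

Definition D f : fps R := euler f.

Lemma DE f n : D f n = n%:R * f n. Proof. by []. Qed.
Lemma DD f g : D (f + g) = D f + D g.
Proof. by apply/funext => n; rewrite fpsDE !DE mulrDr. Qed.
Lemma DN f : D (- f) = - D f.
Proof. by apply/funext => n; rewrite fpsNE !DE mulrN. Qed.
Lemma DB f g : D (f - g) = D f - D g.
Proof. by rewrite DD DN. Qed.
Lemma DM f g : D (f * g) = D f * g + f * D g.
Proof.
apply/funext => n; rewrite DE fpsDE !fpsME mulr_sumr -big_split /=.
apply: eq_bigr => -[i /= lei] _; rewrite !DE.
by rewrite -{1}(subnKC (lei : (i <= n)%N)) natrD; ring.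
Qed.
Lemma DC c : D (fpsC c) = 0.
Proof.
by apply/funext => -[|n]; rewrite DE /fpsC /pscst ?mul0r //= mulr0.
Qed.
Lemma D_nat k : D k%:R = 0.
Proof. by rewrite -(rmorph_nat fpsC) DC. Qed.
Lemma D1 : D (1 : fps R) = 0. Proof. exact: (D_nat 1). Qed.
Lemma D_natM k (f : fps R) : D (k%:R * f) = k%:R * D f.
Proof. by rewrite DM D_nat mul0r add0r. Qed.
Lemma DX f k : D (f ^+ k) = k%:R * f ^+ k.-1 * D f.
Proof.
elim: k => [|k IH]; first by rewrite expr0 !mul0r -[1]/(1%:R) D_nat.
rewrite exprS DM IH /=; case: k {IH} => [|k] /=; first by rewrite expr0; ring.
by rewrite exprS; ring.
Qed.

(* [f = c X^n + O(X^(n+1))]; [c] may vanish. *)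
Definition low (n : nat) (c : C) f :=
  (forall k, (k < n)%N -> f k = 0) /\ f n = c.

Lemma lowM n m a b f g : low n a f -> low m b g -> low (n + m) (a * b) (f * g).
Proof.
move=> [f0 fn] [g0 gm]; split=> [k ltk|].
  rewrite fpsME big1 // => -[i /= lei] _.
  have [lti|leni] := ltnP i n; first by rewrite f0 ?mul0r.
  by rewrite g0 ?mulr0 //; lia.
have ltn : (n < (n + m).+1)%N by lia.
rewrite fpsME (bigD1 (Ordinal ltn)) //= addKn fn gm big1 ?addr0 // => -[i /= lei].
rewrite -val_eqE /= => nei.
have [lti|leni] := ltnP i n; first by rewrite f0 ?mul0r.
by rewrite g0 ?mulr0 //; lia.
Qed.
Lemma low0 f : low 0 (f 0%N) f. Proof. by []. Qed.
Lemma coef_lowM n a f g : low n a f -> (g * f) n = g 0%N * a.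
Proof. by move=> l; have [_] := lowM (low0 g) l. Qed.
Lemma low_D n a f : low n a f -> low n (n%:R * a) (D f).
Proof.
by case=> l1 l2; split=> [j /l1|]; rewrite DE ?l2 // => ->; rewrite mulr0.
Qed.
Lemma low_uniq n a b f : low n a f -> low n b f -> a = b.
Proof. by move=> [_ <-] [_ <-]. Qed.
Lemma lowX m a f k : low m a f -> low (k * m) (a ^+ k) (f ^+ k).
Proof.
move=> fm; elim: k => [|k IH]; last by rewrite mulSn !exprS; apply: lowM.
by split=> //; rewrite fps1E.
Qed.
Lemma lowP f : f != 0 -> exists n a, a != 0 /\ low n a f.
Proof.
move=> f_neq0; have exn : exists n, f n != 0.
  apply: contrapT => nex; case/eqP: f_neq0; apply/funext => n.
  by apply/eqP/negPn/negP => fn; apply: nex; exists n.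
case: (ex_minnP exn) => n fn minn; exists n, (f n); split=> //; split=> // k ltkn.
by apply/eqP/negPn/negP => /minn; rewrite leqNgt ltkn.
Qed.

(** Lowest-order terms multiply to a nonzero term, so there are no zero divisors. Cancellation by
    this lemma stands in for division in the differential equations below. *)
Lemma fpsMI f : f != 0 -> injective (fun g => f * g).
Proof.
move=> /lowP[n [a [a_neq0 fn]]] g h /= fgh; apply/eqP; rewrite -subr_eq0.
apply/negPn/negP => /lowP[m [b [b_neq0 gm]]].
have [_] := lowM fn gm; rewrite mulrBr [f * g]fgh subrr.
by move/eqP; rewrite eq_sym mulf_eq0 (negPf a_neq0) (negPf b_neq0).
Qed.

Lemma fps_neq0 f n : f n != 0 -> f != 0.
Proof. by move=> fn; apply: contraNneq fn => ->. Qed.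

Lemma fpsX_neq0 f m : f 0%N = 1 -> f ^+ m != 0.
Proof. by move=> f0; apply: (@fps_neq0 _ 0%N); rewrite fpsX0 f0 expr1n oner_neq0. Qed.

End FormalPowerSeries.

(** * Substitution of a series without constant term *)

Section Composition.
Variables (R : realType) (u : fps R).
Local Notation C := (R[i]).
Hypothesis u0 : u 0%N = 0.
Implicit Types f g h : fps R.

Lemma fps_expr_eq0 n k : (n < k)%N -> (u ^+ k) n = 0.
Proof.
move=> ltnk; have u1 : low 1 (u 1%N) u by split=> // -[].
by case: (lowX k u1) => + _; apply; rewrite muln1.
Qed.

(** The substitution h(u). Cutting the sum at [k = n] loses nothing, because [u ^+ k] has no term of
    order below [k]. *)
Definition fcomp h : fps R := fun n => \sum_(k < n.+1) h k * (u ^+ k) n.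

(** Reduces each coefficient of h(u) to the evaluation of a polynomial at [u], from which
    multiplicativity and the chain rule are inherited. *)
Lemma fcomp_poly h (p : {poly C}) n :
  (forall k, (k <= n)%N -> p`_k = h k) ->
  fcomp h n = (map_poly (@fpsC R) p).[u] n.
Proof.
move=> ph; set N := maxn (size p) n.+1.
have sz : (size (map_poly (@fpsC R) p) <= N)%N.
  by rewrite (leq_trans (size_poly _ _)) // leq_maxl.
rewrite (horner_coef_wide _ sz) fps_sumE /fcomp.
rewrite (big_ord_widen N (fun k => h k * (u ^+ k) n)) ?leq_maxr //.
rewrite big_mkcond; apply: eq_bigr => -[i /= ltiN] _.
rewrite coef_map fpsCM; case: ifP => [lein|/negbT]; first by rewrite ph.
by rewrite -leqNgt => ltni; rewrite fps_expr_eq0 ?mulr0.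
Qed.

Lemma fcompB f g : fcomp (f - g) = fcomp f - fcomp g.
Proof.
apply/funext => n; rewrite fpsBE /fcomp -sumrB.
by apply: eq_bigr => i _; rewrite fpsBE mulrBl.
Qed.
Lemma fcomp0 : fcomp 0 = 0.
Proof. by have := fcompB 0 0; rewrite !subrr. Qed.
Lemma fcompD f g : fcomp (f + g) = fcomp f + fcomp g.
Proof. by rewrite -{1}[g]opprK -[- g]sub0r !fcompB fcomp0 sub0r opprK. Qed.
Lemma fcomp1 : fcomp 1 = 1.
Proof.
apply/funext => n; rewrite /fcomp big_ord_recl expr0 fps1E mul1r.
by rewrite big1 ?addr0 // => i _; rewrite fps1E mul0r.
Qed.
Lemma fcompM f g : fcomp (f * g) = fcomp f * fcomp g.
Proof.
apply/funext => n; have tr x k := @coef_pstrunc R n x k.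
rewrite (fcomp_poly (p := pstrunc n f * pstrunc n g)) => [|k lekn]; last first.
  by rewrite -(psmul_poly (f := f) (g := g)) // => j lejk; apply: tr (leq_trans lejk lekn).
rewrite rmorphM /= hornerM !fpsME; apply: eq_bigr => -[i /= lein] _.
by congr (_ * _); apply/esym/fcomp_poly => k lek; apply: tr; lia.
Qed.
Lemma fcompXn f k : fcomp (f ^+ k) = fcomp f ^+ k.
Proof. by elim: k => [|k IH]; rewrite ?fcomp1 // !exprS fcompM IH. Qed.
Lemma fcomp_nat k : fcomp k%:R = k%:R.
Proof. by elim: k => [|k IH]; rewrite ?fcomp0 // -natr1 fcompD IH fcomp1. Qed.

Lemma fcompC c : fcomp (fpsC c) = fpsC c.
Proof.
apply/funext => n; rewrite /fcomp big_ord_recl big1 => [|i _]; last by rewrite /fpsC /pscst mul0r.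
by rewrite addr0 expr0 fps1E /fpsC /pscst /=; case: eqP; rewrite ?mulr1 ?mulr0.
Qed.

Lemma fcompX : fcomp (fun n => (n == 1%N)%:R) = u.
Proof.
apply/funext => -[|n]; first by rewrite /fcomp big_ord1 mul0r u0.
rewrite /fcomp !big_ord_recl /= mul0r add0r mul1r.
by rewrite big1 ?addr0 // => i _; rewrite mul0r.
Qed.

(** Chain rule for Euler operators: (t h')(u) equals u h'(u), hence the factor [u] on the left. It
    is proved for polynomials by induction and transferred through truncations. *)
Lemma fcomp_chain h : u * D (fcomp h) = D u * fcomp (D h).
Proof.
apply/funext => n; pose p := pstrunc n h.
have Dpoly (q : {poly C}) :
    u * D (map_poly (@fpsC R) q).[u] = D u * (map_poly (@fpsC R) ('X * q^`())).[u].
  elim/poly_ind: q => [|q c IH].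
    by rewrite deriv0 mulr0 rmorph0 horner0 -[0]/(0%:R) D_nat !mulr0.
  move: IH; rewrite derivD derivC addr0 derivM derivX mulr1.
  rewrite !(rmorphD, rmorphM) /= !map_polyX !map_polyC /= !hornerE DD DM DC.
  set a := (_ q).[u]; set b := (_ q^`()).[u] => IH.
  transitivity (u * D a * u + u * a * D u); first by ring.
  by rewrite IH /=; ring.
have -> : (u * D (fcomp h)) n = (u * D (map_poly (@fpsC R) p).[u]) n.
  rewrite !fpsME; apply: eq_bigr => -[i /= lein] _; rewrite !DE; congr (_ * (_ * _)).
  by apply: fcomp_poly => k lek; apply: coef_pstrunc; lia.
rewrite Dpoly !fpsME; apply: eq_bigr => -[i /= lein] _; congr (_ * _).
apply/esym/fcomp_poly => -[|k] lek; rewrite coefXM /= ?DE ?mul0r //.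
by rewrite coef_deriv coef_pstrunc ?mulr_natl //; lia.
Qed.

(** As [u] is X + O(X^2), a lowest term a X^n of the difference survives the substitution
    unchanged. *)
Lemma fcomp_inj : u 1%N = 1 -> injective fcomp.
Proof.
move=> u1 f g; move/eqP; rewrite -subr_eq0 -fcompB => fg0; apply/eqP; rewrite -subr_eq0.
move: (f - g) fg0 => {f g} h; apply: contraLR => /lowP[n [a [a_neq0 [h0 hn]]]].
apply: (@fps_neq0 _ _ n); rewrite /= /fcomp big_ord_recr /= big1 => [|[i lti] _].
  have low1 : low 1 1 u by split=> // -[].
  have [_] := lowX n low1; rewrite muln1 expr1n => ->.
  by rewrite add0r mulr1 hn.
by rewrite /= h0 ?mul0r.
Qed.

Lemma fcomp_mmap n (h : 'I_n -> fps R) (P : {mpoly C[n]}) :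
  fcomp (mmap (@fpsC R) h P) = mmap (@fpsC R) (fcomp \o h) P.
Proof.
rewrite /mmap (big_morph _ fcompD fcomp0); apply: eq_bigr => m _.
rewrite fcompM fcompC /mmap1 (big_morph _ fcompM fcomp1); congr (_ * _).
by apply: eq_bigr => i _; rewrite fcompXn.
Qed.

End Composition.

(** Substitute v = 1 - f into the geometric series, the inverse of 1 - X. *)
Lemma fps_inv (R : realType) (f : fps R) : f 0%N = 1 -> exists g, f * g = 1.
Proof.
move=> f0; pose v := 1 - f; pose geom : fps R := fun=> 1.
have v0 : v 0%N = 0 by rewrite /v fpsBE f0 fps1E subrr.
pose X : fps R := fun n => (n == 1%N)%:R.
have geomE : (1 - X) * geom = 1.
  apply/funext => -[|n]; first by rewrite fpsM0 fpsBE /X !fps1E subr0 mulr1.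
  rewrite fpsME !big_ord_recl /= big1 => [|i _].
    by rewrite !fpsBE /X !fps1E /=; ring.
  by rewrite fpsBE /X fps1E /= subr0 mul0r.
exists (fcomp v geom).
have /(congr1 (fcomp v)) := geomE.
by rewrite fcompM // fcompB // fcomp1 // fcompX // /v opprB addrC subrK.
Qed.

(** * Convolutions of divisor sums *)

Lemma sum_bij (V : zmodType) (I J : finType) (P : pred I) (Q : pred J)
    (h : I -> J) (h' : J -> I) (F : I -> V) :
  (forall i, P i -> Q (h i) /\ h' (h i) = i) ->
  (forall j, Q j -> P (h' j) /\ h (h' j) = j) ->
  \sum_(i | P i) F i = \sum_(j | Q j) F (h' j).
Proof.
move=> hP h'P; rewrite (reindex_onto h' h) => [|i /hP[]//].
apply: eq_bigl => j; apply/andP/idP => [[/hP[Qj _] /eqP <-]//|/h'P[Pj ->]].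
by rewrite Pj eqxx.
Qed.

Section DivisorSums.
Variables (V : comNzRingType) (n : nat).

(** The entries are bounded by the fixed [n] and not by [m], so that one finite type serves every
    [m <= n] in a convolution. *)
Definition factorizes (m : nat) (p : 'I_n.+1 * 'I_n.+1) : bool :=
  [&& (0 < p.1)%N, (0 < p.2)%N & (p.1 * p.2 == m)%N].

Lemma sum_divisors (F : nat -> V) m : (0 < m <= n)%N ->
  \sum_(d <- divisors m) F d = \sum_(p | factorizes m p) F p.1.
Proof.
case/andP=> m_gt0 lemn.
have -> : \sum_(d <- divisors m) F d = \sum_(d < n.+1 | (d %| m)%N) F d.
  rewrite -(big_mkord (fun d => d %| m)%N) -[RHS]big_filter; apply: perm_big.
  apply: uniq_perm; rewrite ?divisors_uniq ?filter_uniq ?iota_uniq // => d.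
  rewrite -dvdn_divisors // mem_filter mem_index_iota /= andbC.
  have [dvd|] := boolP (d %| m)%N; last by rewrite andbF.
  by rewrite andbT ltnS (leq_trans (dvdn_leq m_gt0 dvd)).
pose h (d : 'I_n.+1) : 'I_n.+1 * 'I_n.+1 := (d, inord (m %/ d)).
rewrite [RHS](reindex_onto h (fun p => p.1)) /= => [|[a x] /and3P[/= a0 x0 /eqP e]].
  apply: eq_bigl => d; rewrite eqxx andbT /factorizes /=.
  have [dvd|ndvd] := boolP (d %| m)%N; last first.
    apply/esym/negbTE/negP => /and3P[_ _ /eqP e]; case/negP: ndvd.
    by rewrite -e dvdn_mulr.
  have q_le : (m %/ d <= n)%N by rewrite (leq_trans (leq_div _ _)).
  have e := divnK dvd; rewrite inordK ?ltnS // mulnC e eqxx.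
  by apply/esym/and3P; split=> //; nia.
by congr pair; apply/val_inj; rewrite /= inordK -e mulKn // ltnS.
Qed.

Local Notation quad := (('I_n.+1 * 'I_n.+1) * ('I_n.+1 * 'I_n.+1))%type.
Local Notation a_ t := (nat_of_ord t.1.1).
Local Notation x_ t := (nat_of_ord t.1.2).
Local Notation b_ t := (nat_of_ord t.2.1).
Local Notation y_ t := (nat_of_ord t.2.2).

(** In a positive solution all four entries are at most [n], so the ordinals discard none. *)
Definition repr_sum (t : quad) : bool :=
  [&& (0 < a_ t)%N, (0 < x_ t)%N, (0 < b_ t)%N, (0 < y_ t)%N
    & (a_ t * x_ t + b_ t * y_ t == n)%N].

Definition mkquad (a x b y : nat) : quad :=
  ((inord a, inord x), (inord b, inord y)).

Lemma eq_mkquad (t : quad) a x b y :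
  a_ t = a -> x_ t = x -> b_ t = b -> y_ t = y -> mkquad a x b y = t.
Proof.
case: t => [[a' x'] [b' y']] /= <- <- <- <-.
by rewrite /mkquad !inord_val.
Qed.

(** The bounds on a + b and x + y keep the images under the bijections below inside the ordinals. *)
Lemma repr_sumP (t : quad) : repr_sum t ->
  [/\ [/\ 0 < a_ t, 0 < x_ t, 0 < b_ t & 0 < y_ t]%N,
      (a_ t * x_ t + b_ t * y_ t = n)%N, (a_ t + b_ t <= n)%N &  (x_ t + y_ t <= n)%N].
Proof.
case/and5P=> a0 x0 b0 y0 /eqP e; split=> //; nia.
Qed.

Lemma sum_swap (P : pred quad) (F : quad -> V) :
  \sum_(t | repr_sum t && P t) F t =
  \sum_(t | repr_sum t && P (t.2, t.1)) F (t.2, t.1).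
Proof.
rewrite (reindex_inj (h := fun t : quad => (t.2, t.1))) /=; last first.
  by move=> [? ?] [? ?] /= [-> ->].
apply: eq_bigl => t; congr (_ && _); rewrite /repr_sum /= addnC.
by apply/and5P/and5P => -[*]; split.
Qed.

(** Exchanging the two products maps the part [p < q] onto the part [q < p], and [F] is invariant
    under this exchange. *)
Lemma sum_trichotomy (p q : quad -> nat) (F : quad -> V) :
  (forall t, p (t.2, t.1) = q t) -> (forall t, q (t.2, t.1) = p t) ->
  (forall t, F (t.2, t.1) = F t) ->
  \sum_(t | repr_sum t) F t =
  (\sum_(t | repr_sum t && (p t < q t)%N) F t) *+ 2 +
  \sum_(t | repr_sum t && (p t == q t)) F t.
Proof.
move=> pq qp FF; rewrite (bigID (fun t => p t == q t)) /= addrC; congr (_ + _).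
rewrite (bigID (fun t => p t < q t)%N) /= mulr2n; congr (_ + _).
  by apply: eq_bigl => t; case: (repr_sum t) => //=; case: ltngtP.
rewrite [RHS]sum_swap; apply: eq_big => [t|t _]; last by rewrite FF.
by rewrite pq qp; case: (repr_sum t) => //=; case: ltngtP.
Qed.

Lemma mkquadE (a x b y : nat) :
  (a <= n)%N -> (x <= n)%N -> (b <= n)%N -> (y <= n)%N ->
  [/\ a_ (mkquad a x b y) = a, x_ (mkquad a x b y) = x,
      b_ (mkquad a x b y) = b & y_ (mkquad a x b y) = y].
Proof. by move=> *; rewrite /= !inordK. Qed.

(* [a x + b y = a (x - y) + (a + b) y] *)
Lemma sum_shear (F : nat -> nat -> V) :
  \sum_(t | repr_sum t && (y_ t < x_ t)%N) F (a_ t) (b_ t) =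
  \sum_(t | repr_sum t && (a_ t < b_ t)%N) F (a_ t) (b_ t - a_ t)%N.
Proof.
pose h (t : quad) := mkquad (a_ t) (x_ t - y_ t) (a_ t + b_ t) (y_ t).
pose h' (t : quad) := mkquad (a_ t) (x_ t + y_ t) (b_ t - a_ t) (y_ t).
have hP (t : quad) : repr_sum t && (y_ t < x_ t)%N ->
    repr_sum (h t) && (a_ (h t) < b_ (h t))%N /\ h' (h t) = t.
  move=> /andP[/repr_sumP[[a0 x0 b0 y0] e le1 le2] lt].
  have [ea ex eb ey] : [/\ a_ (h t) = a_ t, x_ (h t) = (x_ t - y_ t)%N,
    b_ (h t) = (a_ t + b_ t)%N & y_ (h t) = y_ t] by apply: mkquadE; lia.
  split; last by apply: eq_mkquad; rewrite ?ea ?ex ?eb ?ey; lia.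
  by rewrite /repr_sum ea ex eb ey; nia.
have h'P (t : quad) : repr_sum t && (a_ t < b_ t)%N ->
    repr_sum (h' t) && (y_ (h' t) < x_ (h' t))%N /\ h (h' t) = t.
  move=> /andP[/repr_sumP[[a0 x0 b0 y0] e le1 le2] lt].
  have [ea ex eb ey] : [/\ a_ (h' t) = a_ t, x_ (h' t) = (x_ t + y_ t)%N,
    b_ (h' t) = (b_ t - a_ t)%N & y_ (h' t) = y_ t] by apply: mkquadE; lia.
  split; last by apply: eq_mkquad; rewrite ?ea ?ex ?eb ?ey; lia.
  by rewrite /repr_sum ea ex eb ey; nia.
rewrite (sum_bij _ hP h'P); apply: eq_bigr => t /andP[/repr_sumP[_ _ le1 _] _].
by rewrite /= !inordK //; lia.
Qed.

(** If x = y, the equation reads (a + b) x = n: d = a + b is a divisor and a runs from 1 to d -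
    1. *)
Lemma sum_diag_left (F : nat -> nat -> V) : (0 < n)%N ->
  \sum_(t | repr_sum t && (x_ t == y_ t)) F (a_ t) (b_ t) =
  \sum_(d <- divisors n) \sum_(1 <= a < d) F a (d - a)%N.
Proof.
move=> n_gt0; rewrite sum_divisors ?n_gt0 ?leqnn //.
pose Q (i : ('I_n.+1 * 'I_n.+1) * 'I_n.+1) := factorizes n i.1 && (0 < i.2 < i.1.1)%N.
transitivity (\sum_(i | Q i) F i.2 (i.1.1 - i.2)%N); last first.
  rewrite -(pair_big_dep (factorizes n) (fun p (c : 'I_n.+1) => 0 < c < p.1)%N
    (fun p (c : 'I_n.+1) => F c (p.1 - c)%N)) /=.
  apply: eq_bigr => p _.
  rewrite [RHS](big_nat_widen _ _ n.+1) 1?ltnW // big_geq_mkord.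
  by apply: eq_bigl => c; rewrite andbC.
pose h (t : quad) : ('I_n.+1 * 'I_n.+1) * 'I_n.+1 := ((inord (a_ t + b_ t), t.1.2), t.1.1).
pose h' (i : ('I_n.+1 * 'I_n.+1) * 'I_n.+1) := mkquad i.2 i.1.2 (i.1.1 - i.2) i.1.2.
have hP (t : quad) : repr_sum t && (x_ t == y_ t) -> Q (h t) /\ h' (h t) = t.
  move=> /andP[/repr_sumP[[a0 x0 b0 y0] e le1 le2] /eqP xy].
  split; last by apply: eq_mkquad; rewrite /= ?inordK //; lia.
  by rewrite /Q /factorizes /= inordK //; nia.
have h'P i : Q i -> repr_sum (h' i) && (x_ (h' i) == y_ (h' i)) /\ h (h' i) = i.
  case: i => [[d x] a] /andP[/and3P[/= d0 x0 /eqP e] /andP[/= a0 ad]].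
  pose i := (d, x, a).
  have [ld lx la] : [/\ d <= n, x <= n & a <= n]%N by split; rewrite -ltnS.
  have [ea ex eb ey] : [/\ a_ (h' i) = a, x_ (h' i) = x,
    b_ (h' i) = (d - a)%N & y_ (h' i) = x] by apply: mkquadE; rewrite /=; lia.
  split; first by rewrite /repr_sum ea ex ?eb ?ey; nia.
  rewrite /h ea eb subnKC ?(ltnW ad) // inord_val.
  by congr (_, _, _); apply/val_inj.
rewrite (sum_bij _ hP h'P); apply: eq_bigr => -[[d x] a] _.
by have ld := ltn_ord d; rewrite /= !inordK //; lia.
Qed.

(** If a = b, the equation reads a (x + y) = n: a = d is a divisor and x takes n / d - 1 values. *)
Lemma sum_diag_right (F : nat -> V) : (0 < n)%N ->
  \sum_(t | repr_sum t && (a_ t == b_ t)) F (a_ t) =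
  \sum_(d <- divisors n) F d *+ (n %/ d).-1.
Proof.
move=> n_gt0; rewrite (sum_divisors (fun d => F d *+ (n %/ d).-1)) ?n_gt0 ?leqnn //.
pose Q (i : ('I_n.+1 * 'I_n.+1) * 'I_n.+1) := factorizes n i.1 && (0 < i.2 < i.1.2)%N.
transitivity (\sum_(i | Q i) F i.1.1); last first.
  rewrite -(pair_big_dep (factorizes n) (fun p (c : 'I_n.+1) => 0 < c < p.2)%N
    (fun p (c : 'I_n.+1) => F p.1)) /=.
  apply: eq_bigr => p /and3P[d0 x0 /eqP e].
  have -> : (n %/ p.1)%N = p.2 by rewrite -[X in (X %/ _)%N]e mulKn.
  rewrite -subn1 -sumr_const_nat.
  rewrite [RHS](big_nat_widen _ _ n.+1) 1?ltnW // big_geq_mkord.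
  by apply: eq_bigl => c; rewrite andbC.
pose h (t : quad) : ('I_n.+1 * 'I_n.+1) * 'I_n.+1 := ((t.1.1, inord (x_ t + y_ t)), t.1.2).
pose h' (i : ('I_n.+1 * 'I_n.+1) * 'I_n.+1) := mkquad i.1.1 i.2 i.1.1 (i.1.2 - i.2).
have hP (t : quad) : repr_sum t && (a_ t == b_ t) -> Q (h t) /\ h' (h t) = t.
  move=> /andP[/repr_sumP[[a0 x0 b0 y0] e le1 le2] /eqP xy].
  split; last by apply: eq_mkquad; rewrite /= ?inordK //; lia.
  by rewrite /Q /factorizes /= inordK //; nia.
have h'P i : Q i -> repr_sum (h' i) && (a_ (h' i) == b_ (h' i)) /\ h (h' i) = i.
  case: i => [[d x] a] /andP[/and3P[/= d0 x0 /eqP e] /andP[/= a0 ad]].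
  pose i := (d, x, a).
  have [ld lx la] : [/\ d <= n, x <= n & a <= n]%N by split; rewrite -ltnS.
  have [ea ex eb ey] : [/\ a_ (h' i) = d, x_ (h' i) = a,
    b_ (h' i) = d & y_ (h' i) = (x - a)%N] by apply: mkquadE; rewrite /=; lia.
  split; first by rewrite /repr_sum ea ex ?eb ?ey; nia.
  rewrite /h ex ey subnKC ?(ltnW ad) // inord_val.
  by congr (_, _, _); apply/val_inj.
rewrite (sum_bij _ hP h'P); apply: eq_bigr => -[[d x] a] _.
by have ld := ltn_ord d; rewrite /= !inordK //; lia.
Qed.

(* Compare the trichotomy on [(a, b)] with the trichotomy on [(x, y)]: by
   [sum_shear] the off-diagonal parts differ by the sum of [K]. *)
Lemma sum_symmetric (G K : nat -> nat -> V) (G0 : nat -> V) : (0 < n)%N ->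
  (forall a b, G a b = G b a) -> (forall a b, K a b = K b a) ->
  (forall a b, K a (a + b)%N = G a (a + b)%N - G a b) ->
  (forall a, K a a = G a a - G0 a) ->
  \sum_(t | repr_sum t) K (a_ t) (b_ t) =
  \sum_(d <- divisors n) \sum_(1 <= a < d) G a (d - a)%N -
  \sum_(d <- divisors n) G0 d *+ (n %/ d).-1.
Proof.
move=> n_gt0 Gsym Ksym KG KG0.
have tri := @sum_trichotomy (fun t => a_ t) (fun t => b_ t).
have GS1 := tri (fun t => G (a_ t) (b_ t)) (fun=> erefl) (fun=> erefl) (fun=> Gsym _ _).
have GS2 := @sum_trichotomy (fun t => y_ t) (fun t => x_ t) (fun t => G (a_ t) (b_ t))
  (fun=> erefl) (fun=> erefl) (fun=> Gsym _ _).
rewrite (tri (fun t => K (a_ t) (b_ t))) //=.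
rewrite -sum_diag_left // -sum_diag_right //.
have -> : \sum_(t | repr_sum t && (a_ t < b_ t)%N) K (a_ t) (b_ t) =
   \sum_(t | repr_sum t && (a_ t < b_ t)%N) G (a_ t) (b_ t) -
   \sum_(t | repr_sum t && (y_ t < x_ t)%N) G (a_ t) (b_ t).
  rewrite sum_shear -sumrB; apply: eq_bigr => t /andP[_ /ltnW lt].
  by rewrite -{1 2}(subnKC lt) KG.
have -> : \sum_(t | repr_sum t && (a_ t == b_ t)) K (a_ t) (b_ t) =
   \sum_(t | repr_sum t && (a_ t == b_ t)) G (a_ t) (b_ t) -
   \sum_(t | repr_sum t && (a_ t == b_ t)) G0 (a_ t).
  by rewrite -sumrB; apply: eq_bigr => t /andP[_ /eqP <-].
have eqxy : \sum_(t | repr_sum t && (y_ t == x_ t)) G (a_ t) (b_ t) =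
   \sum_(t | repr_sum t && (x_ t == y_ t)) G (a_ t) (b_ t).
  by apply: eq_bigl => t; rewrite eq_sym.
move: GS1; rewrite {}GS2 /= {}eqxy; set B := \sum_(t | _ && (y_ t < _)%N) _.
set A := \sum_(t | _ && (a_ t < _)%N) _ => /= GS.
set P := \sum_(t | _ && (_ == b_ t)) _ in GS *.
transitivity (A *+ 2 + P - B *+ 2 - \sum_(t | repr_sum t && (a_ t == b_ t)) G0 (a_ t)).
  by ring.
by rewrite -GS; ring.
Qed.

End DivisorSums.

(** * Generating series of divisor sums and their products *)

Section DivisorSeries.
Variable R : realType.
Local Notation C := (R[i]).

(* The case distinction matters: [divisors 0 = [:: 1]]. *)
Definition dser (F : nat -> C) : fps R :=
  fun n => if n == 0%N then 0 else \sum_(d <- divisors n) F d.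

Lemma dser_factorizes F m n : (m <= n)%N ->
  dser F m = \sum_(p | @factorizes n m p) F p.1.
Proof.
rewrite /dser; case: posnP => [-> _ | m_gt0 lemn]; last by apply: sum_divisors; rewrite m_gt0.
by rewrite big_pred0 // => p; apply/and3P => -[]; nia.
Qed.

(** The solutions of a x + b y = n are grouped by the value m = a x. *)
Lemma dserM F H n :
  (dser F * dser H) n = \sum_(t | @repr_sum n t) F t.1.1 * H t.2.1.
Proof.
rewrite fpsME (partition_big (fun t : ('I_n.+1 * 'I_n.+1) * ('I_n.+1 * 'I_n.+1) =>
  inord (t.1.1 * t.1.2) : 'I_n.+1) predT) //=.
apply: eq_bigr => -[m /= ltm] _.
rewrite (@dser_factorizes _ _ n) // (@dser_factorizes _ (n - m) n) ?leq_subr //.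
rewrite big_distrlr pair_big /=; apply: eq_bigl => -[[a x] [b y]].
rewrite -val_eqE /= /factorizes /repr_sum /=.
apply/idP/idP; first by move=> ?; rewrite inordK; nia.
by case/andP=> S; rewrite inordK; nia.
Qed.

Lemma dserD F H : dser (fun d => F d + H d) = dser F + dser H.
Proof.
by apply/funext => n; rewrite fpsDE /dser; case: eqP; rewrite ?addr0 ?big_split.
Qed.
Lemma dserB F H : dser (fun d => F d - H d) = dser F - dser H.
Proof.
by apply/funext => n; rewrite fpsBE /dser; case: eqP; rewrite ?subr0 ?sumrB.
Qed.
Lemma dserZ c F : dser (fun d => c * F d) = fpsC c * dser F.
Proof.
by apply/funext => n; rewrite fpsCM /dser; case: eqP; rewrite ?mulr0 ?mulr_sumr.
Qed.

(** For a divisor d of n, d (n / d - 1) = n - d; the factor n is the effect of [D]. *)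
Lemma D_dser F n : (0 < n)%N ->
  \sum_(d <- divisors n) (d%:R * F d) *+ (n %/ d).-1 =
  (D (dser F) - dser (fun d => d%:R * F d)) n.
Proof.
move=> n_gt0; rewrite fpsBE DE /dser eqn0Ngt n_gt0 /= mulr_sumr -sumrB.
rewrite big_seq [RHS]big_seq; apply: eq_bigr => d; rewrite -dvdn_divisors // => dvd.
have e := divnK dvd; rewrite -mulr_natl -subn1 natrB; last first.
  by rewrite divn_gt0 ?(dvdn_gt0 n_gt0 dvd) // dvdn_leq.
by rewrite -[in RHS]e natrM; ring.
Qed.

(* [S m d] is the partial sum of [P a (d - a)] over [a < m]; the term [a = 0] is
   [P 0 d = d h(d)], which cancels against one of the boundary terms. *)
Lemma sum_dser (P Q S : C -> C -> C) (h : C -> C) n : (0 < n)%N ->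
  (forall a b, P a b = P b a) -> (forall a b, Q a b = Q b a) ->
  (forall a b, Q a (a + b) = P a (a + b) - P a b) ->
  (forall a, P a 0 = a * h a) ->
  (forall d, S 0 d = 0) -> (forall m d, S (m + 1) d = S m d + P m (d - m)) ->
  \sum_(t | @repr_sum n t) Q (t.1.1)%:R (t.2.1)%:R =
  (dser (fun d => S d%:R d%:R) - D (dser (fun d => h d%:R))) n.
Proof.
move=> n_gt0 Psym Qsym PQ P0 S0 SS.
have sumS m (d : C) : \sum_(a < m) P a%:R (d - a%:R) = S m%:R d.
  by elim: m => [|m IH]; rewrite ?big_ord0 ?S0 // big_ord_recr /= IH -SS natr1.
rewrite (@sum_symmetric _ n (fun a b => P a%:R b%:R) (fun a b => Q a%:R b%:R)
  (fun d => d%:R * h d%:R)) //; last first.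
- by move=> a; rewrite -P0; have := PQ a%:R 0; rewrite addr0.
- by move=> a b; rewrite natrD PQ.
rewrite (D_dser (fun d => h d%:R)) // !fpsBE /dser eqn0Ngt n_gt0 /= opprB addrA.
congr (_ - _); rewrite -big_split /= big_seq [RHS]big_seq; apply: eq_bigr => d.
rewrite -dvdn_divisors // => /(dvdn_gt0 n_gt0) d_gt0.
rewrite -sumS -(big_mkord predT (fun a => P a%:R (d%:R - a%:R))) [RHS]big_ltn // subr0.
rewrite Psym P0 addrC; congr (_ + _); rewrite big_nat [RHS]big_nat.
by apply: eq_bigr => a /andP[_ /ltnW le]; rewrite natrB.
Qed.

Definition sig (k : nat) : fps R := dser (fun d => d%:R ^+ k).

Lemma sum_sig i j n (c : C) :
  \sum_(t | @repr_sum n t) c * (t.1.1%:R ^+ i * t.2.1%:R ^+ j) = (fpsC c * (sig i * sig j)) n.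
Proof. by rewrite fpsCM -mulr_sumr /sig dserM. Qed.

Lemma sig0 k : sig k 0%N = 0. Proof. by []. Qed.

Lemma fps_eq_pos (f g : fps R) : f 0%N = 0 -> g 0%N = 0 ->
  (forall n, (0 < n)%N -> f n = g n) -> f = g.
Proof.
by move=> f0 g0 fg; apply/funext => n; case: (posnP n) => [->|/fg//]; rewrite f0 g0.
Qed.

(* Faulhaber: [Sk m] is the sum of the [a ^ k] over [a < m]. *)
Let S1 (m : C) := m * (m - 1) / 2%:R.
Let S2 (m : C) := m * (m - 1) * (2%:R * m - 1) / 6%:R.
Let S3 (m : C) := m ^+ 2 * (m - 1) ^+ 2 / 4%:R.
Let S4 (m : C) := m * (m - 1) * (2%:R * m - 1) * (3%:R * m ^+ 2 - 3%:R * m - 1) / 30%:R.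
Let S5 (m : C) := m ^+ 2 * (m - 1) ^+ 2 * (2%:R * m ^+ 2 - 2%:R * m - 1) / 12%:R.
Let S6 (m : C) := m * (m - 1) * (2%:R * m - 1)
  * (3%:R * m ^+ 4 - 6%:R * m ^+ 3 + 3%:R * m + 1) / 42%:R.

(* In the next four lemmas [P] is a polynomial in [(a, b, - a - b)] which is even
   and symmetric in the three arguments; this makes [Q a b = P a b - P a (b - a)]
   symmetric in [a] and [b]. *)
Lemma sig11 : 12%:R * (sig 1 * sig 1) = 5%:R * sig 3 + sig 1 - 6%:R * D (sig 1).
Proof.
apply: fps_eq_pos; rewrite ?fpsBE ?fpsDE ?fps_natM ?DE ?fpsM0 ?sig0; try by ring.
move=> n n_gt0; rewrite !(fpsBE, fpsDE, fps_natM, DE).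
pose Q (a b : C) := 2%:R * (a ^+ 1 * b ^+ 1).
pose P (a b : C) := a ^+ 2 + a * b + b ^+ 2.
(* At b = d - a the polynomial [P] is a^2 - a d + d^2; summing its powers of a by Faulhaber gives
   [S]. *)
pose S (m d : C) := S2 m - d * S1 m + d ^+ 2 * m.
have := @sum_dser P Q S (fun a => a ^+ 1) n n_gt0.
rewrite /Q sum_sig -/(sig 1) (_ : dser _ = fpsC (5%:R / 6%:R) * sig 3 + fpsC (1 / 6%:R) * sig 1);
  last first.
  by rewrite -!dserZ -dserD; congr dser; apply/funext => d; rewrite /S /S1 /S2; field.
rewrite !(fpsBE, fpsDE, fpsCM) DE => E.
transitivity (6%:R * (2%:R * (sig 1 * sig 1) n)); first by ring.
rewrite {}E; first by field.
all: rewrite /P /S /S1 /S2 => *; by field.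
Qed.

Lemma sig13 : 240%:R * (sig 1 * sig 3) =
  21%:R * sig 5 + 10%:R * sig 3 - sig 1 - 30%:R * D (sig 3).
Proof.
apply: fps_eq_pos; rewrite ?fpsBE ?fpsDE ?fps_natM ?DE ?fpsM0 ?sig0; try by ring.
move=> n n_gt0; rewrite !(fpsBE, fpsDE, fps_natM, DE).
pose Q (a b : C) := 4%:R * (a ^+ 3 * b ^+ 1) + 4%:R * (a ^+ 1 * b ^+ 3).
pose P (a b : C) := (a ^+ 2 + a * b + b ^+ 2) ^+ 2.
pose S (m d : C) :=
  S4 m - 2%:R * d * S3 m + 3%:R * d ^+ 2 * S2 m - 2%:R * d ^+ 3 * S1 m + d ^+ 4 * m.
have := @sum_dser P Q S (fun a => a ^+ 3) n n_gt0.
rewrite /Q big_split /= !sum_sig -/(sig 3) (_ : dser _ = fpsC (7%:R / 10%:R) * sig 5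
  + fpsC (1 / 3%:R) * sig 3 - fpsC (1 / 30%:R) * sig 1); last first.
  rewrite -!dserZ -dserD -dserB; congr dser; apply/funext => d.
  by rewrite /S /S1 /S2 /S3 /S4; field.
rewrite !fpsBE fpsDE !fpsCM DE [sig 3 * sig 1]mulrC => E.
transitivity (30%:R * (4%:R * (sig 1 * sig 3) n + 4%:R * (sig 1 * sig 3) n)); first by ring.
rewrite {}E; first by field.
all: rewrite /P /S /S1 /S2 /S3 /S4 => *; by field.
Qed.

Lemma sig33 : 120%:R * (sig 3 * sig 3) = sig 7 - sig 3.
Proof.
apply: fps_eq_pos; rewrite ?fpsBE ?fpsDE ?fps_natM ?DE ?fpsM0 ?sig0; try by ring.
move=> n n_gt0; rewrite !(fpsBE, fpsDE, fps_natM, DE).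
pose Q (a b : C) := 4%:R * (a ^+ 3 * b ^+ 3).
pose P (a b : C) := (a * b * (a + b)) ^+ 2.
pose S (m d : C) := d ^+ 2 * (S4 m - 2%:R * d * S3 m + d ^+ 2 * S2 m).
have := @sum_dser P Q S (fun a => 0) n n_gt0.
rewrite /Q sum_sig (_ : dser (fun d => S _ _) = fpsC (1 / 30%:R) * sig 7
  - fpsC (1 / 30%:R) * sig 3); last first.
  by rewrite -!dserZ -dserB; congr dser; apply/funext => d; rewrite /S /S2 /S3 /S4; field.
rewrite (_ : dser (fun=> 0) = 0); last first.
  by apply/funext => m; rewrite /dser big1 ?if_same.
rewrite !fpsBE DE fps0E !fpsCM => E.
transitivity (30%:R * (4%:R * (sig 3 * sig 3) n)); first by ring.
rewrite {}E; first by field.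
all: rewrite /P /S /S1 /S2 /S3 /S4 => *; by field.
Qed.

Lemma sig15 : 504%:R * (sig 1 * sig 5) =
  20%:R * sig 7 + 21%:R * sig 5 + sig 1 - 42%:R * D (sig 5).
Proof.
apply: fps_eq_pos; rewrite ?fpsBE ?fpsDE ?fps_natM ?DE ?fpsM0 ?sig0; try by ring.
move=> n n_gt0; rewrite !(fpsBE, fpsDE, fps_natM, DE).
pose Q (a b : C) := 6%:R * (a ^+ 5 * b ^+ 1) + 6%:R * (a ^+ 1 * b ^+ 5).
(* The cube contributes 14 a^3 b^3 to [Q] and the square contributes 4 a^3 b^3, so the factor 7/2
   removes this monomial. *)
pose P (a b : C) := (a ^+ 2 + a * b + b ^+ 2) ^+ 3 - 7%:R / 2%:R * (a * b * (a + b)) ^+ 2.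
pose S (m d : C) := S6 m - 3%:R * d * S5 m + 6%:R * d ^+ 2 * S4 m - 7%:R * d ^+ 3 * S3 m
  + 6%:R * d ^+ 4 * S2 m - 3%:R * d ^+ 5 * S1 m + d ^+ 6 * m
  - 7%:R / 2%:R * d ^+ 2 * (S4 m - 2%:R * d * S3 m + d ^+ 2 * S2 m).
have := @sum_dser P Q S (fun a => a ^+ 5) n n_gt0.
rewrite /Q big_split /= !sum_sig -/(sig 5) (_ : dser _ = fpsC (10%:R / 21%:R) * sig 7
  + fpsC (1 / 2%:R) * sig 5 + fpsC (1 / 42%:R) * sig 1); last first.
  rewrite -!dserZ -!dserD; congr dser; apply/funext => d.
  by rewrite /S /S1 /S2 /S3 /S4 /S5 /S6; field.
rewrite !(fpsBE, fpsDE, fpsCM) DE [sig 5 * sig 1]mulrC => E.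
transitivity (42%:R * (6%:R * (sig 1 * sig 5) n + 6%:R * (sig 1 * sig 5) n)); first by ring.
rewrite {}E; first by field.
all: rewrite /P /S /S1 /S2 /S3 /S4 /S5 /S6 => *; by field.
Qed.

(** * Ramanujan's differential equations *)

Local Notation E2 := (E2 R : fps R).
Local Notation E4 := (E4 R : fps R).
Local Notation E6 := (E6 R : fps R).

Lemma eis_sig c k : (eis c k : fps R) = 1 + fpsC c * sig k.
Proof.
apply/funext => n; rewrite fpsDE fps1E fpsCM /sig /dser /eis.
case: eqP => _; rewrite ?mulr0 ?addr0 ?add0r //; congr (_ * _).
by rewrite /sigma natr_sum; apply: eq_bigr => d _; rewrite natrX.
Qed.

Lemma E2_sig : E2 = 1 - 24%:R * sig 1.
Proof. by rewrite /Defs.E2 eis_sig rmorphN rmorph_nat mulNr. Qed.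
Lemma E4_sig : E4 = 1 + 240%:R * sig 3.
Proof. by rewrite /Defs.E4 eis_sig rmorph_nat. Qed.
Lemma E6_sig : E6 = 1 - 504%:R * sig 5.
Proof. by rewrite /Defs.E6 eis_sig rmorphN rmorph_nat mulNr. Qed.

Lemma ramanujan_E2 : 12%:R * D E2 = E2 ^+ 2 - E4.
Proof.
rewrite E2_sig E4_sig DB D1 D_natM sub0r.
have -> : 12%:R * - (24%:R * D (sig 1)) = (- 48%:R) * (6%:R * D (sig 1)) by ring.
have -> : 6%:R * D (sig 1) = 5%:R * sig 3 + sig 1 - 12%:R * (sig 1 * sig 1).
  by rewrite sig11; ring.
by ring.
Qed.

Lemma ramanujan_E4 : 3%:R * D E4 = E2 * E4 - E6.
Proof.
rewrite E2_sig E4_sig E6_sig DD D1 D_natM add0r.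
have -> : 3%:R * (240%:R * D (sig 3)) = 24%:R * (30%:R * D (sig 3)) by ring.
have -> : 30%:R * D (sig 3) =
    21%:R * sig 5 + 10%:R * sig 3 - sig 1 - 240%:R * (sig 1 * sig 3).
  by rewrite sig13; ring.
by ring.
Qed.

(** The square of E4 brings in [sig 3 * sig 3], which [sig33] matches with the [sig 7] of [sig15];
    [sig33] is the identity E4^2 = E8. *)
Lemma ramanujan_E6 : 2%:R * D E6 = E2 * E6 - E4 ^+ 2.
Proof.
rewrite E2_sig E4_sig E6_sig DB D1 D_natM sub0r.
have -> : 2%:R * - (504%:R * D (sig 5)) = - 24%:R * (42%:R * D (sig 5)) by ring.
have -> : 42%:R * D (sig 5) =
    20%:R * sig 7 + 21%:R * sig 5 + sig 1 - 504%:R * (sig 1 * sig 5).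
  by rewrite sig15; ring.
have -> : sig 7 = sig 3 + 120%:R * (sig 3 * sig 3) by rewrite sig33; ring.
by ring.
Qed.

End DivisorSeries.

(** * The hypergeometric side *)

Section Hypergeometric.
Variable R : realType.
Local Notation C := (R[i]).
Implicit Types (f g : fps R) (a b lam : C).

Definition fpsT : fps R := fun n => (n == 1%N)%:R.

Lemma fpsTM0 f : (fpsT * f) 0%N = 0.
Proof. by rewrite fpsM0 mul0r. Qed.
Lemma fpsTMS f n : (fpsT * f) n.+1 = f n.
Proof.
rewrite fpsME !big_ord_recl /= mul0r add0r subSS subn0 mul1r.
by rewrite big1 ?addr0 // => i _; rewrite mul0r.
Qed.
Lemma D_fpsT : D fpsT = fpsT.
Proof. by apply/funext => -[|[|n]]; rewrite DE /fpsT ?mul1r ?mulr0. Qed.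

Lemma pochS a n : poch a n.+1 = poch a n * (a + n%:R).
Proof. by rewrite /poch big_ord_recr. Qed.
Lemma poch1 n : poch (1 : C) n = n`!%:R.
Proof.
elim: n => [|n IH]; first by rewrite /poch big_ord0.
by rewrite pochS IH factS mulnC natrM addrC natr1.
Qed.

Lemma hyp2F1_0 a b lam : hyp2F1 a b 1 lam 0%N = 1.
Proof. by rewrite /hyp2F1 /poch !big_ord0 expr0 !invr1 !mulr1. Qed.

Lemma hyp2F1_S a b lam n :
  (n.+1)%:R ^+ 2 * hyp2F1 a b 1 lam n.+1 =
  lam * ((n%:R + a) * (n%:R + b)) * hyp2F1 a b 1 lam n.
Proof.
rewrite /hyp2F1 !poch1 !pochS factS natrM [lam ^+ _]exprS.
have fn0 : n`!%:R != 0 :> C by rewrite pnatr_eq0 -lt0n fact_gt0.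
have n0 : (n.+1)%:R != 0 :> C by rewrite pnatr_eq0.
by field; rewrite fn0 /= addrC natr1.
Qed.

(** Coefficient n + 1 of the equation carries the factor (n + 1)^2, which is nonzero, so it
    determines the next coefficient. This is how F2 is recognized in [f2_eq]. *)
Lemma hyp2F1_uniq a b lam f : f 0%N = 1 ->
  D (D f) = fpsC lam * fpsT * (D (D f) + fpsC (a + b) * D f + fpsC (a * b) * f) ->
  f = hyp2F1 a b 1 lam.
Proof.
move=> f0 ode; apply/funext; elim=> [|n IH]; first by rewrite hyp2F1_0.
have /(congr1 (@^~ n.+1)) := ode; rewrite /= -mulrA fpsCM fpsTMS !(fpsDE, fpsCM, DE).
have n0 : (n.+1)%:R ^+ 2 != 0 :> C by rewrite expf_neq0 ?pnatr_eq0.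
rewrite IH => e; apply: (mulfI n0); rewrite hyp2F1_S.
transitivity (n.+1%:R * (n.+1%:R * f n.+1)); first by ring.
by rewrite e; ring.
Qed.

Lemma hyp2F1_ode a b lam (f : fps R := hyp2F1 a b 1 lam) :
  D (D f) = fpsC lam * fpsT * (D (D f) + fpsC (a + b) * D f + fpsC (a * b) * f).
Proof.
apply/funext => -[|n]; rewrite -mulrA fpsCM ?fpsTM0 ?fpsTMS !(fpsDE, fpsCM, DE) ?mul0r ?mulr0 //.
by rewrite mulrA -expr2 hyp2F1_S -/f; ring.
Qed.

(** This is (1 + lam t) D f = a lam t f, the equation of (1 + lam t)^a. *)
Lemma binser_ode a lam (f : fps R := binser a lam) :
  D f = fpsC lam * fpsT * (fpsC a * f - D f).
Proof.
apply/funext => -[|n]; rewrite -mulrA fpsCM ?fpsTM0 ?fpsTMS !(fpsBE, fpsCM, DE) ?mul0r ?mulr0 //.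
rewrite /f /binser /gbinom big_ord_recr factS natrM exprS /=.
have fn0 : n`!%:R != 0 :> C by rewrite pnatr_eq0 -lt0n fact_gt0.
have n0 : (n.+1)%:R != 0 :> C by rewrite pnatr_eq0.
by field; rewrite fn0 /= addrC natr1.
Qed.

Lemma binser0 a lam : binser a lam 0%N = 1.
Proof. by rewrite /binser /gbinom big_ord0 expr0 invr1 !mulr1. Qed.

(** Equal logarithmic derivatives: a lowest term a X^n of f - g has n > 0, since both constant terms
    are 1, and the relation forces n a = 0. *)
Lemma wronskian_eq0 f g : f 0%N = 1 -> g 0%N = 1 -> g * D f = f * D g -> f = g.
Proof.
move=> f0 g0 W; apply/eqP; rewrite -subr_eq0; apply/negPn/negP => /lowP[n [a [a0 l]]].
have n_gt0 : (0 < n)%N.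
  by case: n l => // -[_]; rewrite fpsBE f0 g0 subrr => e; rewrite -e eqxx in a0.
have := lowM (low0 g) (low_D l); have := lowM l (low0 (D g)).
rewrite addn0 add0n DE mul0r mulr0 g0 mul1r.
have -> : g * D (f - g) = (f - g) * D g by rewrite DB mulrBr W; ring.
move=> h1 /(low_uniq h1)/esym/eqP; rewrite mulf_eq0 (negPf a0) orbF pnatr_eq0.
by rewrite eqn0Ngt n_gt0.
Qed.

(** * The first-order system linking F1 and F2 *)

Let X : fps R := fpsC 1728%:R * fpsT.
Let s : fps R := sqrtser R.
Let f1 : fps R := F1 R.
Let f2 : fps R := F2 R.

Lemma D_X : D X = X. Proof. by rewrite /X DM DC D_fpsT mul0r add0r. Qed.
Lemma X0 : X 0%N = 0. Proof. by rewrite /X fpsM0 mulr0. Qed.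
Lemma f1_0 : f1 0%N = 1. Proof. exact: hyp2F1_0. Qed.
Lemma f2_0 : f2 0%N = 1. Proof. exact: hyp2F1_0. Qed.
Lemma s0 : s 0%N = 1. Proof. exact: binser0. Qed.
Lemma s_neq0 : s != 0.
Proof. by apply: (@fps_neq0 _ _ 0); rewrite s0 oner_neq0. Qed.

Lemma fpsC_nat_div k m : (0 < m)%N -> m%:R * fpsC (k%:R / m%:R) = k%:R :> fps R.
Proof.
move=> m0; rewrite -!(rmorph_nat (@fpsC R)) -rmorphM /= mulrC divfK //.
by rewrite pnatr_eq0 -lt0n.
Qed.

Lemma Ds : 2%:R * (1 - X) * D s = - X * s.
Proof.
have := @binser_ode (1 / 2%:R) (- 1728%:R); rewrite -/(sqrtser R) -/s /= => e.
have h := fpsC_nat_div 1 (isT : (0 < 2)%N).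
rewrite rmorphN mulNr -/X in e.
transitivity (2%:R * D s - 2%:R * X * D s); first by ring.
rewrite {1}e.
transitivity (- X * (2%:R * fpsC (1%:R / 2%:R)) * s); first by ring.
by rewrite h; ring.
Qed.

(** Both sides have constant term 1 and the same logarithmic derivative, - X / (1 - X). *)
Lemma s_sqr : s ^+ 2 = 1 - X.
Proof.
apply: wronskian_eq0; rewrite ?fpsX0 ?fpsBE ?s0 ?X0 ?fps1E ?expr1n ?subr0 //.
rewrite DX DB D1 D_X /= expr1.
transitivity (2%:R * (1 - X) * D s * s); first by ring.
by rewrite Ds; ring.
Qed.

Lemma sDs : 2%:R * s * D s = - X.
Proof.
apply: (fpsMI s_neq0) => /=; transitivity (2%:R * s ^+ 2 * D s); first by ring.
by rewrite s_sqr Ds; ring.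
Qed.

Lemma f1_ode : 144%:R * (1 - X) * D (D f1) = X * (72%:R * D f1 + 5%:R * f1).
Proof.
have := @hyp2F1_ode (1 / 12%:R) (5%:R / 12%:R) 1728%:R.
rewrite -/(F1 R) -/f1 -/X /= => e.
have h1 : 144%:R * fpsC (1 / 12%:R + 5%:R / 12%:R) = 72%:R :> fps R.
  by rewrite -!(rmorph_nat (@fpsC R)) -rmorphM /=; congr fpsC; field.
have h2 : 144%:R * fpsC (1 / 12%:R * (5%:R / 12%:R)) = 5%:R :> fps R.
  by rewrite -!(rmorph_nat (@fpsC R)) -rmorphM /=; congr fpsC; field.
transitivity (144%:R * D (D f1) - 144%:R * X * D (D f1)); first by ring.
by rewrite {1}e -h1 -h2; ring.
Qed.

Let y := s * (f1 + 12%:R * D f1).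

(** With the definition of [y], rewritten as 12 s D f1 = y - s f1, this turns the second-order
    equation of [f1] into a first-order system for (f1, y). *)
Lemma Dy : 12%:R * s * D y = s * y - f1.
Proof.
rewrite /y DM DD D_natM.
transitivity (6%:R * (2%:R * s * D s) * (f1 + 12%:R * D f1)
  + s ^+ 2 * 12%:R * D f1 + s ^+ 2 * 144%:R * D (D f1)); first by ring.
rewrite sDs s_sqr [_ * D (D f1)](_ : _ = X * (72%:R * D f1 + 5%:R * f1)); last first.
  by rewrite -f1_ode; ring.
transitivity (s ^+ 2 * (f1 + 12%:R * D f1) - f1); last by ring.
by rewrite s_sqr; ring.
Qed.

(** The two hypotheses are the first-order system. Eliminating [f1] leaves the hypergeometric
    equation with parameters -1/12 and 7/12, whose solution with constant term 1 is unique. *)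
Lemma f2_eq z : z = s * (f1 + 12%:R * D f1) -> 12%:R * s * D z = s * z - f1 -> f2 = z.
Proof.
move=> zE Dz; apply/esym/hyp2F1_uniq.
  by rewrite zE fpsM0 s0 fpsDE f1_0 fps_natM DE mul0r mulr0 addr0 mul1r.
rewrite -/X; have wDz : 12%:R * (1 - X) * D z = (1 - X) * z - s * f1.
  transitivity (s * (12%:R * s * D z)); last by rewrite Dz -s_sqr; ring.
  by rewrite -s_sqr; ring.
have DwDz : 12%:R * (1 - X) * D (D z) =
    12%:R * X * D z - X * z + (1 - X) * D z - D s * f1 - s * D f1.
  have := congr1 (@D R) wDz; rewrite DB !DM D_nat !DB D1 D_X mul0r !sub0r add0r => e.
  transitivity (12%:R * - X * D z + 12%:R * (1 - X) * D (D z) + 12%:R * X * D z).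
    by ring.
  by rewrite e; ring.
(* After multiplication by [s] the part in [z] becomes - X f1 by [Dz] and the part in [D s] becomes
   X f1 by [sDs]. *)
have sum0 : 12%:R * X * D z - X * z - 2%:R * D s * f1 = 0.
  apply: (fpsMI s_neq0); rewrite /= mulr0.
  transitivity (X * (12%:R * s * D z - s * z) - (2%:R * s * D s) * f1); first by ring.
  by rewrite Dz sDs; ring.
have h1 : 144%:R * fpsC (- (1 / 12%:R) + 7%:R / 12%:R) = 72%:R :> fps R.
  by rewrite -!(rmorph_nat (@fpsC R)) -rmorphM /=; congr fpsC; field.
have h2 : 144%:R * fpsC (- (1 / 12%:R) * (7%:R / 12%:R)) = - 7%:R :> fps R.
  by rewrite -!(rmorph_nat (@fpsC R)) -rmorphM -rmorphN /=; congr fpsC; field.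
apply: (@fps_natMI R 144) => //=.
transitivity (X * (144%:R * D (D z) + 72%:R * D z - 7%:R * z)); last first.
  by rewrite -h1 -[- (7%:R * z)]mulNr -h2; ring.
apply/eqP; rewrite -subr_eq0; apply/eqP.
transitivity (12%:R * (12%:R * (1 - X) * D (D z)) - X * (72%:R * D z - 7%:R * z)).
  by ring.
rewrite DwDz.
transitivity (6%:R * (12%:R * X * D z - X * z - 2%:R * D s * f1)
  + (12%:R * (1 - X) * D z) - (1 - X) * z + s * f1 + (z - s * (f1 + 12%:R * D f1))); first by ring.
by rewrite sum0 wDz -zE; ring.
Qed.

Lemma f2E : f2 = y.
Proof. exact: f2_eq Dy. Qed.

(** * Equations satisfied by the generators of the hypergeometric ring *)

Local Notation G2 := (G2 R : fps R).
Local Notation G4 := (G4 R : fps R).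
Local Notation G6 := (G6 R : fps R).

Lemma G2E : G2 = f1 * f2. Proof. by []. Qed.
Lemma G4E : G4 = f1 ^+ 4. Proof. exact: pspowE. Qed.
Lemma G6E : G6 = s * f1 ^+ 6.
Proof. by rewrite -pspowE. Qed.

Lemma G2_0 : G2 0%N = 1. Proof. by rewrite G2E fpsM0 f1_0 f2_0 mulr1. Qed.
Lemma G4_0 : G4 0%N = 1. Proof. by rewrite G4E fpsX0 f1_0 expr1n. Qed.
Lemma G6_0 : G6 0%N = 1. Proof. by rewrite G6E fpsM0 s0 fpsX0 f1_0 expr1n mulr1. Qed.

Lemma G4_DF f : G4 * DF f = G6 * D f.
Proof.
have -> : DF f = s * f1 ^+ 2 * D f by rewrite -pspowE.
by rewrite G4E G6E; ring.
Qed.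

(** Equivalent to t = (G4^3 - G6^2) / (1728 G4^3), the counterpart of t = 1/j. In the uniqueness
    argument it takes the place of the third differential equation. *)
Lemma G_sqr : G6 ^+ 2 = (1 - X) * G4 ^+ 3.
Proof. by rewrite G4E G6E -s_sqr; ring. Qed.

(** Ramanujan's equation for E4 with [DF] as derivation, cleared of the denominator in D_F = (G6 /
    G4) D. *)
Lemma G4_ode : 3%:R * (G6 * D G4) = G4 * (G2 * G4 - G6).
Proof.
by rewrite G2E G4E G6E DX f2E /y; ring.
Qed.

Lemma G2_ode : 12%:R * (G6 * D G2) = G4 * (G2 ^+ 2 - G4).
Proof.
rewrite G2E G4E G6E DM f2E.
transitivity (f1 ^+ 6 * (12%:R * s * D f1 * y + f1 * (12%:R * s * D y))); first by ring.
rewrite Dy (_ : 12%:R * s * D f1 = y - s * f1); last by rewrite /y; ring.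
by ring.
Qed.

End Hypergeometric.

(** * Expansion in the inverse of the modular function *)

Section Uniformizer.
Variable R : realType.
Local Notation C := (R[i]).
Local Notation E := (E2 R : fps R).
Local Notation A := (E4 R : fps R).
Local Notation B := (E6 R : fps R).
Local Notation k := (fpsC (1728%:R : C)).
Implicit Types f g : fps R.

Lemma E2_0 : E 0%N = 1. Proof. by []. Qed.
Lemma E4_0 : A 0%N = 1. Proof. by []. Qed.
Lemma E6_0 : B 0%N = 1. Proof. by []. Qed.

Lemma E4_neq0 : A != 0.
Proof. by apply: (@fps_neq0 _ _ 0%N); rewrite E4_0 oner_neq0. Qed.

Lemma inverse_j_exists : exists u : fps R,
  [/\ u 0%N = 0, u 1%N = 1 & A ^+ 3 * (k * u) = A ^+ 3 - B ^+ 2].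
Proof.
have [|g Ag] := @fps_inv R (A ^+ 3); first by rewrite fpsX0 E4_0 expr1n.
have k0 : 1728%:R != 0 :> C by rewrite pnatr_eq0.
(* The witness is 1/j, with [g] the inverse of E4^3. *)
exists (fpsC 1728%:R^-1 * ((A ^+ 3 - B ^+ 2) * g)).
set u := _ * _.
have uE : A ^+ 3 * (k * u) = A ^+ 3 - B ^+ 2.
  by rewrite /u [k * _]mulrA -rmorphM /= divff // rmorph1 mul1r mulrCA Ag mulr1.
have u0 : u 0%N = 0.
  by rewrite /u fpsCM fpsM0 fpsBE !fpsX0 E4_0 E6_0 !expr1n subrr mul0r mulr0.
split=> //.
have := congr1 (@^~ 1%N) uE; rewrite /= fpsBE !fpsX1 //.
rewrite fpsME !big_ord_recl big_ord0 /= !fpsCM u0 mulr0 mulr0 addr0 addr0.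
rewrite fpsX0 E4_0 expr1n mul1r => e; apply: (mulfI k0); rewrite e mulr1.
have s1 j : sigma j 1 = 1%N by rewrite /sigma big_seq1 exp1n.
(* The linear coefficient of E4^3 - E6^2 is 3 * 240 + 2 * 504 = 1728. *)
rewrite /Defs.E4 /Defs.E6 /eis /= !s1 !mulr1 mulrN opprK -!natrM -natrD.
by congr (_%:R).
Qed.

Section Expansion.
Variable u : fps R.
Hypotheses (u0 : u 0%N = 0) (u1 : u 1%N = 1).
Hypothesis uE : A ^+ 3 * (k * u) = A ^+ 3 - B ^+ 2.

(** Differentiate [uE] and insert Ramanujan's equations for E4 and E6; the terms containing E2
    cancel. *)
Lemma D_inverse_j : A * D u = B * u.
Proof.
have k0 : k != 0 by apply: (@fps_neq0 _ _ 0%N); rewrite /= pnatr_eq0.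
apply: (fpsMI k0) => /=.
have -> : k * (A * D u) = A * D (k * u) by rewrite DM DC; ring.
have -> : k * (B * u) = B * (k * u) by ring.
move: uE; move: (k * u) => v vE; apply: (fpsMI (fpsX_neq0 3 E4_0)) => /=.
have vE' : A ^+ 3 * (1 - v) = B ^+ 2 by rewrite mulrBr vE; ring.
have := congr1 (@D R) vE; rewrite DM DB !DX /= => e.
transitivity (A * (3%:R * A ^+ 2 * D A * v + A ^+ 3 * D v) - A ^+ 3 * (3%:R * D A) * v).
  by ring.
rewrite e.
transitivity ((3%:R * D A) * (A ^+ 3 * (1 - v)) - A * B * (2%:R * D B)); first by ring.
rewrite vE' ramanujan_E4 ramanujan_E6.
transitivity (B * (A ^+ 3 * v)); last by ring.
by rewrite vE; ring.
Qed.

Lemma D_fcomp f : A * D (fcomp u f) = B * fcomp u (D f).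
Proof.
have u_neq0 : u != 0 by apply: (@fps_neq0 _ _ 1%N); rewrite u1 oner_neq0.
apply: (fpsMI u_neq0) => /=.
transitivity (A * (u * D (fcomp u f))); first by ring.
rewrite (fcomp_chain u0); transitivity (A * D u * fcomp u (D f)); first by ring.
by rewrite D_inverse_j; ring.
Qed.

Lemma fcomp_at0 f : fcomp u f 0%N = f 0%N.
Proof. by rewrite /fcomp big_ord1 expr0 fps1E mulr1. Qed.

Let X2 := fcomp u (G2 R).
Let X4 := fcomp u (G4 R).
Let X6 := fcomp u (G6 R).

Lemma X2_ode : 12%:R * (X6 * (A * D X2)) = B * (X4 * (X2 ^+ 2 - X4)).
Proof.
rewrite /X2 D_fcomp -/X2 /X2 /X4 /X6.
transitivity (B * (12%:R * (fcomp u (G6 R) * fcomp u (D (G2 R))))); first by ring.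
by rewrite -(fcomp_nat u 12) -!fcompM // G2_ode fcompM // fcompB // fcompXn.
Qed.

Lemma X4_ode : 3%:R * (X6 * (A * D X4)) = B * (X4 * (X2 * X4 - X6)).
Proof.
rewrite /X4 D_fcomp -/X4 /X2 /X4 /X6.
transitivity (B * (3%:R * (fcomp u (G6 R) * fcomp u (D (G4 R))))); first by ring.
by rewrite -(fcomp_nat u 3) -!fcompM // G4_ode fcompM // fcompB // fcompM.
Qed.

Lemma X_sqr : A ^+ 3 * X6 ^+ 2 = B ^+ 2 * X4 ^+ 3.
Proof.
rewrite /X6 -fcompXn // G_sqr fcompM // fcompB // fcomp1 // fcompM // fcompC // fcompX //.
by rewrite mulrA mulrBr uE fcompXn // -/X4; ring.
Qed.

(** The linearization at (1, 1, 1) of the system for (E2, E4, E6), acting on coefficients of order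
    [N]. Eliminating [b] and [c] leaves 72 N^2 a = 0. *)
Lemma linearized_eq0 (N a b c : C) : N != 0 ->
  12%:R * N * a = 2%:R * a - b -> 3%:R * N * b = a + b - c -> 2%:R * c = 3%:R * b ->
  [/\ a = 0, b = 0 & c = 0].
Proof.
move=> N0 ea eb ec.
have bE : b = 2%:R * a - 12%:R * N * a by rewrite ea; ring.
have h : 6%:R * N * b = 2%:R * a - b.
  transitivity (2%:R * (3%:R * N * b)); first by ring.
  transitivity (2%:R * a + 2%:R * b - 2%:R * c); first by rewrite eb; ring.
  by rewrite ec; ring.
have : 72%:R * N ^+ 2 * a = 0.
  transitivity (2%:R * a - (2%:R * a - 12%:R * N * a)
    - 6%:R * N * (2%:R * a - 12%:R * N * a)); first by ring.
  by rewrite -bE h; ring.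
move/eqP; rewrite !mulf_eq0 (negPf N0) !pnatr_eq0 /= => /eqP a0.
have b0 : b = 0 by rewrite bE a0; ring.
split=> //; move/eqP: ec; rewrite b0 mulr0 mulf_eq0 pnatr_eq0 /=.
by move/eqP.
Qed.

(* Both triples solve the same system with constant terms [1]; the lowest order
   term of their difference is killed by the linearized system. *)
Lemma fcomp_G : [/\ X2 = E, X4 = A & X6 = B].
Proof.
suff X_E n : [/\ (X2 - E) n = 0, (X4 - A) n = 0 & (X6 - B) n = 0].
  by split; apply/eqP; rewrite -subr_eq0; apply/eqP/funext => n; case: (X_E n).
have X20 : X2 0%N = 1 by rewrite /X2 fcomp_at0 G2_0.
have X40 : X4 0%N = 1 by rewrite /X4 fcomp_at0 G4_0.
have X60 : X6 0%N = 1 by rewrite /X6 fcomp_at0 G6_0.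
elim/ltn_ind: n => n IH.
have [->|n_gt0] := posnP n; first by rewrite !fpsBE X20 X40 X60 E2_0 E4_0 E6_0 subrr.
have l2 : low n ((X2 - E) n) (X2 - E) by split=> // m /IH[].
have l4 : low n ((X4 - A) n) (X4 - A) by split=> // m /IH[].
have l6 : low n ((X6 - B) n) (X6 - B) by split=> // m /IH[].
move: ((X2 - E) n) ((X4 - A) n) ((X6 - B) n) l2 l4 l6 => a b c l2 l4 l6.
have nat0 m : (m%:R : fps R) 0%N = m%:R by rewrite fpsMn fps1E.
have const := (fpsM0, fpsDE, fpsNE, fpsX0, nat0, DE, X20, X40, X60, E2_0, E4_0, E6_0).
apply: (@linearized_eq0 n%:R); first by rewrite pnatr_eq0 -lt0n.
(* The difference of the two E2 equations is arranged so that each term contains a difference of the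
   triples; its coefficient [n] then involves only constant terms and a, b, c. *)
- have e : 12%:R * (A * D X2) * (X6 - B) + 12%:R * (A * B) * D (X2 - E) =
    (B * (X2 ^+ 2 - X4) - B * A) * (X4 - A) + B * A * (X2 + E) * (X2 - E).
    rewrite DB.
    transitivity (12%:R * (X6 * (A * D X2)) - A * B * (12%:R * D E)); first by ring.
    by rewrite X2_ode ramanujan_E2; ring.
  have := congr1 (@^~ n) e; rewrite /= 2!fpsDE (coef_lowM _ (low_D l2)).
  rewrite (coef_lowM _ l6) (coef_lowM _ l4) (coef_lowM _ l2) !const => e'.
  by apply: (etrans _ (etrans e' _)); ring.
- have e : 3%:R * (A * D X4) * (X6 - B) + 3%:R * (A * B) * D (X4 - A) =
    (B * (X2 * X4 - X6) + B * A * E) * (X4 - A) + B * A * X4 * (X2 - E)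
    + (- (B * A)) * (X6 - B).
    rewrite DB.
    transitivity (3%:R * (X6 * (A * D X4)) - A * B * (3%:R * D A)); first by ring.
    by rewrite X4_ode ramanujan_E4; ring.
  have := congr1 (@^~ n) e; rewrite /= 3!fpsDE (coef_lowM _ (low_D l4)).
  rewrite !(coef_lowM _ l6) (coef_lowM _ l4) (coef_lowM _ l2) !const => e'.
  by apply: (etrans _ (etrans e' _)); ring.
have e : A ^+ 3 * (X6 + B) * (X6 - B) = B ^+ 2 * (X4 ^+ 2 + X4 * A + A ^+ 2) * (X4 - A).
  transitivity (A ^+ 3 * X6 ^+ 2 - A ^+ 3 * B ^+ 2); first by ring.
  by rewrite X_sqr; ring.
have := congr1 (@^~ n) e; rewrite /= (coef_lowM _ l6) (coef_lowM _ l4) !const => e'.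
by apply: (etrans _ (etrans e' _)); ring.
Qed.

End Expansion.

Definition vec3 (x y z : fps R) : 'I_3 -> fps R := fun i => [:: x; y; z]`_i.

(** Identifies the coefficientwise evaluation with a ring morphism, so that substitution and Leibniz
    arguments apply. *)
Lemma mpeval3E (x y z : fps R) P : mpeval3 x y z P = mmap (@fpsC R) (vec3 x y z) P.
Proof.
apply/funext => n; rewrite /mpeval3 /mmap fps_sumE; apply: eq_bigr => m _.
rewrite fpsCM /mmap1 !big_ord_recl big_ord0 mulr1 /vec3 /=.
have -> : inord 1 = lift ord0 ord0 :> 'I_3 by apply/val_inj; rewrite /= inordK.
have -> : inord 2 = lift ord0 (lift ord0 ord0) :> 'I_3 by apply/val_inj; rewrite /= inordK.
by rewrite !pspowE.
Qed.

Lemma fcomp_Fser u P : u 0%N = 0 -> u 1%N = 1 -> A ^+ 3 * (k * u) = A ^+ 3 - B ^+ 2 ->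
  fcomp u (Fser P) = QMser P.
Proof.
move=> u0 u1 uE; rewrite /Fser /QMser !mpeval3E fcomp_mmap //.
have [e2 e4 e6] := fcomp_G u0 u1 uE.
rewrite /mmap; apply: eq_bigr => m _; congr (_ * _); apply: mmap1_eq.
by case=> -[|[|[|//]]].
Qed.

(** Substitution turns the factor G6 / G4 of D_F into E6 / E4, exactly the factor in [D_fcomp]; E4
    is cancelled at the end. *)
Lemma fcomp_DF u f : u 0%N = 0 -> u 1%N = 1 -> A ^+ 3 * (k * u) = A ^+ 3 - B ^+ 2 ->
  fcomp u (DF f) = D (fcomp u f).
Proof.
move=> u0 u1 uE; apply: (fpsMI E4_neq0) => /=.
have [_ e4 e6] := fcomp_G u0 u1 uE.
by rewrite D_fcomp // -{1}e4 -fcompM // G4_DF fcompM // e6.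
Qed.

(** * Closure of quasimodular forms under the derivation *)

Local Notation ev := (mmap (@fpsC R) (vec3 E A B)).

Lemma ev_X i : ev 'X_i = vec3 E A B i.
Proof. by rewrite mmapX mmap1U. Qed.

Lemma D_ev_div m f P : (0 < m)%N -> m%:R * D f = ev P ->
  D f = ev ((m%:R^-1)%:MP * P).
Proof.
move=> m_gt0 e; apply: (@fps_natMI R m) => //=; rewrite e rmorphM /= mmapC mulrA.
by rewrite -(rmorph_nat (@fpsC R)) -rmorphM /= divff ?pnatr_eq0 -?lt0n // rmorph1 mul1r.
Qed.

(** Membership of [f] itself is carried along because the product rule for [D] involves the
    undifferentiated factors. *)
Definition ev_D_closed f := (exists P, f = ev P) /\ (exists Q, D f = ev Q).

Lemma ev_D_closedD f g : ev_D_closed f -> ev_D_closed g -> ev_D_closed (f + g).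
Proof.
move=> [[P ->] [P' eP]] [[Q ->] [Q' eQ]]; split; first by exists (P + Q); rewrite rmorphD.
by exists (P' + Q'); rewrite DD eP eQ rmorphD.
Qed.

Lemma ev_D_closedM f g : ev_D_closed f -> ev_D_closed g -> ev_D_closed (f * g).
Proof.
move=> [[P ->] [P' eP]] [[Q ->] [Q' eQ]]; split; first by exists (P * Q); rewrite rmorphM.
by exists (P' * Q + P * Q'); rewrite DM eP eQ rmorphD /= !rmorphM.
Qed.

Lemma ev_D_closedC c : ev_D_closed (fpsC c).
Proof.
by split; [exists c%:MP | exists 0]; rewrite ?DC ?raddf0 // mmapC.
Qed.

Lemma ev_D_closed_gen i : ev_D_closed (vec3 E A B i).
Proof.
split; first by exists 'X_i; rewrite ev_X.
pose x (j : 'I_3) : {mpoly C[3]} := 'X_j.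
have [x0 x1 x2] : [/\ ev (x (inord 0)) = E, ev (x (inord 1)) = A & ev (x (inord 2)) = B].
  by rewrite !ev_X /vec3 !inordK.
case: i => -[|[|[|//]]] lti; rewrite /vec3 /=.
- exists ((12%:R^-1)%:MP * (x (inord 0) ^+ 2 - x (inord 1))); apply: D_ev_div => //.
  by rewrite ramanujan_E2 rmorphB rmorphXn /= x0 x1.
- exists ((3%:R^-1)%:MP * (x (inord 0) * x (inord 1) - x (inord 2))); apply: D_ev_div => //.
  by rewrite ramanujan_E4 rmorphB rmorphM /= x0 x1 x2.
exists ((2%:R^-1)%:MP * (x (inord 0) * x (inord 2) - x (inord 1) ^+ 2)); apply: D_ev_div => //.
by rewrite ramanujan_E6 rmorphB rmorphM rmorphXn /= x0 x1 x2.
Qed.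

Lemma QMser_closed P : exists Q, QMser Q = euler (QMser P) :> pser R.
Proof.
suff [_ [Q eQ]] : ev_D_closed (ev P) by exists Q; rewrite /QMser !mpeval3E -eQ.
have c1 : ev_D_closed 1 by rewrite -(rmorph1 (@fpsC R)); apply: ev_D_closedC.
have c0 : ev_D_closed 0 by rewrite -(rmorph0 (@fpsC R)); apply: ev_D_closedC.
rewrite /mmap; apply: (big_ind ev_D_closed) => // [|m _]; first exact: ev_D_closedD.
apply: ev_D_closedM; first exact: ev_D_closedC.
apply: (big_ind ev_D_closed) => // [|i _]; first exact: ev_D_closedM.
elim: (m i) => // j IH; rewrite exprS; apply: ev_D_closedM => //.
exact: ev_D_closed_gen.
Qed.

End Uniformizer.

(** Both evaluations are algebra morphisms on the polynomial ring, so equality of their kernels is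
    an isomorphism of their images matching the generators. *)
Theorem theorem2p2 (R : realType) :
  (* the map QM_* -> F, P(E2,E4,E6) |-> P(G2,G4,G6), is well defined and injective *)
  (forall P : {mpoly R[i][3]}, Fser P = (fun _ => 0) <-> QMser P = (fun _ => 0)) /\
  (* QM_* is closed under D = q d/dq *)
  (forall P : {mpoly R[i][3]}, exists Q : {mpoly R[i][3]}, QMser Q = euler (QMser P)) /\
  (* F is closed under D_F *)
  (forall P : {mpoly R[i][3]}, exists Q : {mpoly R[i][3]}, Fser Q = DF (Fser P)) /\
  (* the isomorphism carries D to D_F *)
  (forall P Q : {mpoly R[i][3]}, QMser Q = euler (QMser P) -> Fser Q = DF (Fser P)).
Proof.
have [u [u0 u1 uE]] := inverse_j_exists R.
have comp_Fser P := fcomp_Fser P u0 u1 uE.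
have inj := fcomp_inj u0 u1.
have DP (P Q : {mpoly R[i][3]}) : QMser Q = euler (QMser P) -> Fser Q = DF (Fser P).
  (* Both sides agree after the substitution t = u, which is injective and carries [DF] to [D]. *)
  by move=> e; apply: (inj (Fser Q) (DF (Fser P))); rewrite fcomp_DF // !comp_Fser.
split=> [P|]; last split; last split=> //; last first.
(* The polynomial expressing D on the q-series side also expresses D_F. *)
- by move=> P; have [Q /DP] := QMser_closed P; exists Q.
- exact: QMser_closed.
split=> [F0|Q0].
  by rewrite -comp_Fser F0; apply: fcomp0.
by apply: (inj (Fser P) 0); rewrite comp_Fser Q0; apply/esym/fcomp0.
Qed.
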